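(* Consider a linear ODE $du^N/dt+A^Nu^N=g^N$ in $\mathbb{R}^N$ with output $\mathcal{H}\circ\Phi^N(u^N(t))$, where $\mathcal{H}$ and $\Phi^N$ are linear, and let $W^N\subseteq\mathbb{R}^N$ be the space for estimation. Assume that $W^N$ and the space of outputs are Hilbert spaces with inner products $\langle\cdot,\cdot\rangle_N$ and $\langle\cdot,\cdot\rangle_Y$ inducing the norms $\|\cdot\|_N$ and $\|\cdot\|_Y$. Let $\{e_1^N,\dots,e_s^N\}$ be a basis of $W^N$ and define the $s\times s$ matrices $$G_{ij}=\big\langle \mathcal{H}\circ\Phi^N(e^{-A^Nt}e_i^N),\ \mathcal{H}\circ\Phi^N(e^{-A^Nt}e_j^N)\big\rangle_Y,\qquad S_{ij}=\langle e_i^N,e_j^N\rangle_N .$$ Let $\sigma_{min}$ be the smallest eigenvalue of $G$ relative to $S$, i.e. the smallest $\sigma$ such that $G\xi=\sigma S\xi$ for some nonzero $\xi\in\mathbb{R}^s$ (when the basis is orthonormal, $S=I$ and $\sigma_{min}$ is the smallest eigenvalue of $G$). Let $\rho>0$ and let $u^N$ be a trajectory of the ODE with $u^N(0)\in W^N$. Then the quantity $\epsilon^N$ defined in the context satisfies $(\epsilon^N)^2=\sigma_{min}\rho^2$; that is, the unobservability index of $u^N(0)$ in $W^N$ is $$\frac{\rho}{\epsilon^N}=\frac{1}{\sqrt{\sigma_{min}}}$$ (with both sides read as $+\infty$ if $\sigma_{min}=0$).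
   Context: $A^N$ is a constant $N\times N$ real matrix and $g^N$ a given continuous forcing term on $[t_0,t_1]$, with initial time $t_0=0$. $\Phi^N:\mathbb{R}^N\to X$ is a linear map into a Banach space $X$, and $\mathcal{H}$ is a linear operator from $X$ to $\mathbb{R}^p$; for a function $v:[t_0,t_1]\to\mathbb{R}^N$, $\mathcal{H}\circ\Phi^N(v)$ denotes the output function $t\mapsto\mathcal{H}(\Phi^N(v(t)))$ on $[t_0,t_1]$, an element of the output space with norm $\|\cdot\|_Y$. In $G_{ij}$ the arguments are the functions of $t$ given by $t\mapsto \mathcal{H}(\Phi^N(e^{-A^Nt}e_i^N))$. Definition of $\epsilon^N$. Given $\rho>0$ and a trajectory $u^N$ of the ODE with $u^N(0)\in W^N$, $\epsilon^N=\inf\|\mathcal{H}\circ\Phi^N(\hat u^N)-\mathcal{H}\circ\Phi^N(u^N)\|_Y$, the infimum over all $\hat u^N$ satisfying $d\hat u^N/dt+A^N\hat u^N=g^N$, $\hat u^N(0)\in W^N$, $\|\hat u^N(0)-u^N(0)\|_N=\rho$. The ratio $\rho/\epsilon^N$ is called the unobservability index of $u^N(0)$ in $W^N$. *)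

(* Defs.v *)
From HB Require Import structures.
From mathcomp Require Import all_boot all_order all_algebra sesquilinear.
From mathcomp Require Import all_classical all_reals all_analysis.
Set Implicit Arguments.
Unset Strict Implicit.
Unset Printing Implicit Defensive.
Import Order.TTheory GRing.Theory Num.Theory.
Import numFieldNormedType.Exports.
Local Open Scope classical_set_scope.
Local Open Scope ring_scope.

Definition expmx (R : realType) (N : nat) (A : 'M[R]_N) : 'M[R]_N :=
  limn (series (fun k : nat => (k`!%:R)^-1 *: A ^+ k)).

(* Classical solutions of du/dt + A u = g on [0, t1]. A trajectory is a total
   function of which only the values on [0, t1] are constrained. At the
   endpoints only continuity is required: for g continuous on [0, t1], the
   equation then also holds there with one-sided derivatives. *)
Definition is_trajectory (R : realType) (N : nat) (A : 'M[R]_N)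
    (g : R -> 'cV[R]_N) (t1 : R) (u : R -> 'cV[R]_N) : Prop :=
  {within `[0, t1], continuous u} /\
  forall t : R, 0 < t < t1 ->
    derivable u t 1 /\ 'D_1 u t + A *m u t = g t.

Definition time (R : realType) (t1 : R) : Type := {t : R | 0 <= t <= t1}.

(* A Hilbert space of R^p-valued functions on T, possibly up to identification
   of some functions (as in L^2): [output_fun] is the vector space of the
   functions that represent an element, and [output_class] sends such a function
   to the element it represents; its values on other functions are junk. *)
Record outputSpace (R : realType) (T : Type) (p : nat) := OutputSpace {
  output_car :> completeNormedModType R;
  output_ip : {dot output_car for idfun};
  output_normE : forall y : output_car, `|y| = Num.sqrt (output_ip y y);
  output_fun : {pred (T -> 'cV[R]_p)};
  output_class : (T -> 'cV[R]_p) -> output_car;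
  output_fun_submod : GRing.submod_closed output_fun;
  output_class_linear : forall (a : R) (f h : T -> 'cV[R]_p),
    f \in output_fun -> h \in output_fun ->
    output_class (a *: f + h) = a *: output_class f + output_class h;
  output_class_surj : forall y : output_car,
    exists2 f, f \in output_fun & output_class f = y
}.

Definition output (R : realType) (N p : nat) (X : completeNormedModType R)
    (Phi : {linear 'cV[R]_N -> X}) (H : {linear X -> 'cV[R]_p}) (t1 : R)
    (v : R -> 'cV[R]_N) : time t1 -> 'cV[R]_p :=
  fun t => H (Phi (v (val t))).

(* The inner product on W lives on the subtype [subvs_of W]; [ipW] and [normW]
   read it on vectors of R^N and are meaningful only for vectors in W. *)
Definition ipW (R : realType) (N : nat) (W : {vspace 'cV[R]_N})
    (ipN : {dot (subvs_of W) for idfun}) (x y : 'cV[R]_N) : R :=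
  ipN (vsproj W x) (vsproj W y).

Definition normW (R : realType) (N : nat) (W : {vspace 'cV[R]_N})
    (ipN : {dot (subvs_of W) for idfun}) (x : 'cV[R]_N) : R :=
  Num.sqrt (ipW ipN x x).

Definition gramG (R : realType) (N p s : nat) (A : 'M[R]_N)
    (X : completeNormedModType R) (Phi : {linear 'cV[R]_N -> X})
    (H : {linear X -> 'cV[R]_p}) (t1 : R) (Y : outputSpace R (time t1) p)
    (e : s.-tuple 'cV[R]_N) : 'M[R]_s :=
  let y (i : 'I_s) : Y :=
    output_class Y
      (output Phi H (fun t : R => expmx (- (t *: A)) *m tnth e i)) in
  \matrix_(i, j) output_ip Y (y i) (y j).

Definition gramS (R : realType) (N s : nat) (W : {vspace 'cV[R]_N})
    (ipN : {dot (subvs_of W) for idfun}) (e : s.-tuple 'cV[R]_N) : 'M[R]_s :=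
  \matrix_(i, j) ipW ipN (tnth e i) (tnth e j).

Definition relative_eigenvalue (R : realType) (s : nat) (G S : 'M[R]_s)
    (sigma : R) : Prop :=
  exists xi : 'cV[R]_s, xi != 0 /\ G *m xi = sigma *: (S *m xi).

Definition is_smallest_relative_eigenvalue (R : realType) (s : nat)
    (G S : 'M[R]_s) (sigma : R) : Prop :=
  relative_eigenvalue G S sigma /\
  forall tau : R, relative_eigenvalue G S tau -> sigma <= tau.

Definition epsilonN (R : realType) (N p : nat) (A : 'M[R]_N)
    (g : R -> 'cV[R]_N) (X : completeNormedModType R)
    (Phi : {linear 'cV[R]_N -> X}) (H : {linear X -> 'cV[R]_p}) (t1 : R)
    (Y : outputSpace R (time t1) p) (W : {vspace 'cV[R]_N})
    (ipN : {dot (subvs_of W) for idfun}) (rho : R) (u : R -> 'cV[R]_N)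
    : \bar R :=
  ereal_inf [set `| output_class Y (output Phi H v)
                    - output_class Y (output Phi H u) |%:E
            | v in [set v : R -> 'cV[R]_N |
                    [/\ is_trajectory A g t1 v, v 0 \in W
                      & normW ipN (v 0 - u 0) = rho]]].

(* The quotient is in the extended reals, where 0^-1 = +oo: the index of u(0)
   is +oo if epsilonN = 0 (for 0 < rho). *)
Definition unobservability_index (R : realType) (N p : nat) (A : 'M[R]_N)
    (g : R -> 'cV[R]_N) (X : completeNormedModType R)
    (Phi : {linear 'cV[R]_N -> X}) (H : {linear X -> 'cV[R]_p}) (t1 : R)
    (Y : outputSpace R (time t1) p) (W : {vspace 'cV[R]_N})
    (ipN : {dot (subvs_of W) for idfun}) (rho : R) (u : R -> 'cV[R]_N)
    : \bar R :=
  (rho%:E / epsilonN A g Phi H Y ipN rho u)%E.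

(* Main.v *)
Require Import Defs.
From HB Require Import structures.
From mathcomp Require Import all_boot all_order all_algebra sesquilinear.
From mathcomp Require Import all_classical all_reals all_analysis.
From mathcomp Require Import ring lra.
Set Implicit Arguments.
Unset Strict Implicit.
Unset Printing Implicit Defensive.
Import Order.TTheory GRing.Theory Num.Theory.
Import numFieldNormedType.Exports.
Local Open Scope classical_set_scope.
Local Open Scope ring_scope.

(** A trajectory starting at distance [rho] from [u] differs from it by a
    solution [exp(-tA) w] of the homogeneous equation, with [w] in [W] of norm
    [rho]: the flow run backwards along a homogeneous solution is constant. In
    coordinates [xi] of [w], the squared norms of the output difference and of
    [w] are the quadratic forms of [G] and [S]. The generalised Rayleigh
    quotient of the two forms attains its minimum by compactness; at the minimum
    [sigma] the positive semidefinite form [G - sigma S] vanishes, so the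
    minimiser is a relative eigenvector, and [sigma] is the smallest relative
    eigenvalue since every eigenvalue is a value of the quotient. *)

(** * Quadratic forms and the generalised Rayleigh quotient *)

Section bform.
Context {R : realType} {s : nat}.

Definition bform (M : 'M[R]_s) (x y : 'cV[R]_s) : R := (x^T *m M *m y) 0 0.

Lemma bformE M x y :
  bform M x y = \sum_i \sum_j x i 0 * M i j * y j 0.
Proof.
rewrite /bform mxE exchange_big /=; apply: eq_bigr => j _.
rewrite mxE mulr_suml; apply: eq_bigr => i _.
by rewrite mxE.
Qed.

Lemma bformDl M x y z : bform M (x + y) z = bform M x z + bform M y z.
Proof. by rewrite /bform linearD /= !mulmxDl mxE. Qed.

Lemma bformDr M x y z : bform M x (y + z) = bform M x y + bform M x z.
Proof. by rewrite /bform mulmxDr mxE. Qed.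

Lemma bformZl M a x y : bform M (a *: x) y = a * bform M x y.
Proof. by rewrite /bform linearZ /= -!scalemxAl mxE. Qed.

Lemma bformZr M a x y : bform M x (a *: y) = a * bform M x y.
Proof. by rewrite /bform -scalemxAr mxE. Qed.

Lemma bform0l M x : bform M 0 x = 0.
Proof. by rewrite /bform trmx0 !mul0mx mxE. Qed.

Lemma bformC M x y : M^T = M -> bform M x y = bform M y x.
Proof.
move=> MT; rewrite !bformE exchange_big /=; apply: eq_bigr => j _.
by apply: eq_bigr => i _; rewrite -[in LHS]MT mxE; ring.
Qed.

Lemma bformB M M' a x y :
  bform (M - a *: M') x y = bform M x y - a * bform M' x y.
Proof. by rewrite /bform mulmxBr mulmxBl -scalemxAr -scalemxAl !mxE. Qed.

(** Row vectors are the space in which compactness of the unit sphere is invoked below. *)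
Lemma continuous_bform_tr M : continuous (fun x : 'rV[R]_s => bform M x^T x^T).
Proof.
have -> : (fun x : 'rV[R]_s => bform M x^T x^T) =
    (fun x => \sum_i \sum_j x 0 i * M i j * x 0 j).
  apply/funext => x; rewrite bformE; apply: eq_bigr => i _.
  by apply: eq_bigr => j _; rewrite !mxE.
apply: continuous_big => [|i _]; first exact: add_continuous.
apply: continuous_big => [|j _ x]; first exact: add_continuous.
apply: (@continuousM _ _ (fun x : 'rV[R]_s => x 0 i * M i j)).
  apply: (@continuousM _ _ (fun x : 'rV[R]_s => x 0 i)).
    exact: coord_continuous.
  exact: cst_continuous.
exact: coord_continuous.
Qed.

(* A zero of a nonnegative quadratic form is a minimum, so the first variation
   of the form vanishes there. *)
Lemma psd_kernel M x : M^T = M -> (forall y, 0 <= bform M y y) ->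
  bform M x x = 0 -> M *m x = 0.
Proof.
move=> MT M0 Mx.
have Mxy y : bform M y x = 0.
  have key (t : R) : 0 <= t * 2 * bform M y x + t ^+ 2 * bform M y y.
    have := M0 (x + t *: y).
    rewrite bformDl !bformDr Mx !bformZl !bformZr (bformC x y MT).
    by set a := bform M y x; set b := bform M y y; nra.
  set a := bform M y x in key *; set b := bform M y y in key *.
  have b0 : 0 <= b by exact: M0.
  (* Close to the minimiser [- a / b] of the quadratic in [t], but defined for [b = 0] too; the
     value there is a negative multiple of [a ^+ 2], which forces [a = 0]. *)
  have := key (- a / (b + 1)).
  have -> : - a / (b + 1) * 2 * a + (- a / (b + 1)) ^+ 2 * b
      = - (a ^+ 2) * ((b + 2) / (b + 1) ^+ 2).
    by field; rewrite gt_eqF//; lra.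
  rewrite mulNr oppr_ge0 pmulr_lle0; last first.
    by apply: divr_gt0; [lra|apply: exprn_gt0; lra].
  by move=> h; apply/eqP; rewrite -sqrf_eq0 eq_le h sqr_ge0.
apply/matrixP => i j; rewrite ord1 [RHS]mxE.
have := Mxy (delta_mx i 0).
by rewrite /bform trmx_delta -mulmxA -rowE mxE.
Qed.

Lemma rayleigh_min (G S : 'M[R]_s) : (0 < s)%N ->
  (forall x : 'cV[R]_s, x != 0 -> 0 < bform S x x) ->
  exists sigma : R, exists2 x : 'cV[R]_s, x != 0 &
    bform G x x = sigma * bform S x x /\
    forall y, sigma * bform S y y <= bform G y y.
Proof.
move=> s0 Spos.
(* The unit sphere of the max norm is compact, and a quotient of two quadratic forms is constant on
   rays, so its minimum over [K] is global. *)
pose K : set 'rV[R]_s := [set x | `|x| = 1].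
have K0 : K !=set0.
  case: s s0 @K {G Spos S} => // n _ K; exists (const_mx 1); rewrite /K /=.
  rewrite /Num.Def.normr/= mx_normrE; apply/le_anti/andP; split.
    by apply: bigmax_le => // i _; rewrite mxE normr1.
  by apply/bigmax_geP; right; exists (0, 0); rewrite //= mxE normr1.
have Kc : compact K.
  apply: bounded_closed_compact.
    exists 1; split; first exact: num_real.
    by move=> M M1 x /= ->; exact: ltW.
  have -> : K = Num.norm @^-1` [set 1] by apply/seteqP; split.
  apply: closed_comp; last exact: closed_eq.
  by move=> x _; exact: norm_continuous.
have Kn0 x : K x -> x^T != 0.
  rewrite /K /= => x1; apply/eqP => /(congr1 trmx); rewrite trmxK trmx0 => x0.
  by move: x1; rewrite x0 normr0 => /esym/eqP; rewrite oner_eq0.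
pose f (x : 'rV[R]_s) := bform G x^T x^T / bform S x^T x^T.
have cf : {within K, continuous f}.
  apply: continuous_in_subspaceT => x; rewrite inE => /Kn0 xn0.
  apply: (@continuousM _ _ (fun x : 'rV[R]_s => bform G x^T x^T)).
    exact: continuous_bform_tr.
  apply: (@continuousV _ _ (fun x : 'rV[R]_s => bform S x^T x^T)).
    by rewrite gt_eqF// Spos.
  exact: continuous_bform_tr.
have [x /[!inE] Kx minx] := compact_EVT_min K0 Kc cf.
have Sx := Spos _ (Kn0 _ Kx).
exists (f x), x^T; first exact: Kn0.
split; first by rewrite /f divfK// gt_eqF.
move=> y; have [->|y0] := eqVneq y 0; first by rewrite !bform0l mulr0.
have ny : 0 < `|y^T|.
  rewrite normr_gt0; apply: contra y0 => /eqP/(congr1 trmx)/eqP.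
  by rewrite trmxK trmx0.
have := minx (`|y^T|^-1 *: y^T); rewrite inE => /(_ _)/wrap[].
  by rewrite /K /= normrZ ger0_norm ?invr_ge0 ?ltW// mulVf// gt_eqF.
rewrite {2}/f linearZ /= trmxK !bformZl !bformZr !mulrA -!expr2.
rewrite -mulf_div divff ?mul1r; last by rewrite expf_neq0// invr_eq0 gt_eqF.
by rewrite ler_pdivlMr// Spos.
Qed.

Lemma rayleigh_eigenvalue (G S : 'M[R]_s) (sigma : R) (x : 'cV[R]_s) :
  G^T = G -> S^T = S ->
  (forall x : 'cV[R]_s, x != 0 -> 0 < bform S x x) ->
  x != 0 -> bform G x x = sigma * bform S x x ->
  (forall y, sigma * bform S y y <= bform G y y) ->
  is_smallest_relative_eigenvalue G S sigma.
Proof.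
move=> GT ST Spos x0 Gx minx; split.
  exists x; split => //; apply/eqP.
  rewrite scalemxAl -subr_eq0 -mulmxBl; apply/eqP.
  apply: psd_kernel.
  - by rewrite linearB linearZ /= GT ST.
  - by move=> y; rewrite bformB subr_ge0.
  - by rewrite bformB Gx subrr.
move=> tau [y [y0 Gy]].
have := minx y.
rewrite {2}/bform -mulmxA Gy -scalemxAr mulmxA mxE -/(bform _ _ _).
by rewrite ler_pM2r// Spos.
Qed.

End bform.

(** * Power series dominated by an exponential *)

Section exponential_type.
Context {R : realType}.

(** Domination by the coefficients of C exp(Mx): strong enough for convergence at every point, and
    stable under formal differentiation. *)
Definition exponential_type (c : R^nat) : Prop :=
  exists C M : R, 0 <= M /\ forall k, `|c k| <= C * (M ^+ k / k`!%:R).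

Lemma cvg_exponential_type (c : R^nat) (x : R) :
  exponential_type c -> cvgn (pseries c x).
Proof.
move=> [C [M [M0 cM]]]; apply: normed_cvg.
have C0 : 0 <= C.
  by have := cM 0; rewrite fact0 expr0 divr1 mulr1; exact: le_trans.
apply: (@series_le_cvg _ _ (fun k => C * (M * `|x|) ^+ k / k`!%:R)).
- by move=> k; exact: normr_ge0.
- by move=> k; rewrite divr_ge0// mulr_ge0// exprn_ge0// mulr_ge0.
- move=> k /=; rewrite normrM normrX exprMn.
  apply: le_trans (ler_wpM2r _ (cM k)) _; first exact: exprn_ge0.
  by rewrite le_eqVlt; apply/orP; left; apply/eqP; ring.
rewrite (_ : (fun k => _) = C *: exp_coeff (M * `|x|)).
  exact/is_cvg_seriesZ/is_cvg_series_exp_coeff.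
by apply/funext => k; rewrite -mulrA.
Qed.

(** The factor k+1 brought down by differentiation cancels in (k+1)!, leaving one more power of [M],
    which the constant absorbs. *)
Lemma exponential_type_diffs (c : R^nat) :
  exponential_type c -> exponential_type (pseries_diffs c).
Proof.
move=> [C [M [M0 cM]]]; exists (C * M), M; split => // k.
rewrite /pseries_diffs normrM ger0_norm//.
apply: le_trans (ler_wpM2l _ (cM k.+1)) _ => //.
rewrite le_eqVlt; apply/orP; left; apply/eqP; rewrite factS natrM exprS; field.
by rewrite ?nat1r !pnatr_eq0 -lt0n fact_gt0.
Qed.

Lemma is_derive_pseries (c : R^nat) (x : R) : exponential_type c ->
  is_derive x 1 (fun t => limn (pseries c t))
    (limn (pseries (pseries_diffs c) x)).
Proof.
(* Termwise differentiation at [x] asks that the series and its first two formal derivatives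
   converge at a point farther from 0 than [x]. *)
move=> ec; apply: (@pseries_snd_diffs _ _ (`|x| + 1)).
- exact: cvg_exponential_type.
- exact/cvg_exponential_type/exponential_type_diffs.
- exact/cvg_exponential_type/exponential_type_diffs/exponential_type_diffs.
- by rewrite [ltRHS]ger0_norm ?ltrDl// addr_ge0.
Qed.

Lemma pseries0 (c : R^nat) : pseries c 0 @ \oo --> c 0.
Proof.
apply: cvg_near_cst; exists 1%N => // n /= n0.
rewrite /pseries /series /= big_ltn// expr0 mulr1 big1_seq ?addr0//.
move=> i /=; rewrite mem_index_iota expr0n => /andP[/lt0n_neq0/negPf-> _].
by rewrite mulr0.
Qed.

End exponential_type.

(** * The matrix exponential, entry by entry *)

Lemma cvg_mx_entries {R : realType} {m n : nat} {T : Type} (F : set_system T)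
    {FF : Filter F} (f : T -> 'M[R]_(m, n)) (l : 'M[R]_(m, n)) :
  (forall i j, f x i j @[x --> F] --> l i j) -> f x @[x --> F] --> l.
Proof.
move=> fl A [P Pl PA].
apply: (filterS (P := fun x => forall i j, P i j (f x i j))).
  by move=> x Px; apply: PA.
apply: filter_forall => i; apply: filter_forall => j; exact: fl (Pl i j).
Qed.

Section matrix_exponential.
Context {R : realType} {N : nat}.
Implicit Types (A B : 'M[R]_N).

(** Coefficient of t^k in the (i, j) entry of exp(tB). *)
Definition exp_entry B i j (k : nat) : R := (B ^+ k) i j / k`!%:R.

Lemma exp_entry_exponential_type B i j : exponential_type (exp_entry B i j).
Proof.
(* [M] bounds every absolute row sum of [B], so multiplication by [B] raises a bound on the entries
   by at most the factor [M]. *)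
pose M := 1 + \sum_i \sum_j `|B i j|.
have M0 : 0 <= M by rewrite addr_ge0// sumr_ge0// => ? _; rewrite sumr_ge0.
have row_le l : \sum_j `|B l j| <= M.
  apply: (@le_trans _ _ (\sum_i \sum_j `|B i j|)); last by rewrite lerDr.
  by rewrite [leRHS](bigD1 l)//= lerDl sumr_ge0// => ? _; rewrite sumr_ge0.
have powM k : forall i' j', `|(B ^+ k) i' j'| <= M ^+ k.
  elim: k => [|k IH] i' j'.
    by rewrite !expr0 mxE; case: eqP => _ /=; rewrite ?normr1 ?normr0.
  rewrite !exprS mxE; apply: le_trans (ler_norm_sum _ _ _) _.
  apply: (@le_trans _ _ (\sum_l `|B i' l| * M ^+ k)).
    by apply: ler_sum => l _; rewrite normrM ler_wpM2l.
  by rewrite -mulr_suml ler_wpM2r// exprn_ge0.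
exists 1, M; split => // k; rewrite mul1r normrM normfV normr_nat.
by rewrite ler_wpM2r.
Qed.

Lemma expr_scalemx B t k : (t *: B) ^+ k = t ^+ k *: B ^+ k.
Proof.
elim: k => [|k IH]; first by rewrite !expr0 scale1r.
rewrite !exprS IH -[LHS]/((t *: B) *m (t ^+ k *: B ^+ k)).
by rewrite -scalemxAl -scalemxAr scalerA.
Qed.

Lemma expmx_entry B t i j :
  expmx (t *: B) i j = limn (pseries (exp_entry B i j) t).
Proof.
(* [expmx] is a [limn], meaningful only once the series converges; [L] is the candidate limit, and
   convergence to it is checked entrywise. *)
pose L : 'M[R]_N := \matrix_(i, j) limn (pseries (exp_entry B i j) t).
suff -> : expmx (t *: B) = L by rewrite mxE.
apply/cvg_lim => //; apply: cvg_mx_entries => i' j'; rewrite mxE.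
rewrite (_ : (fun n => _) = pseries (exp_entry B i' j') t).
  exact/cvg_exponential_type/exp_entry_exponential_type.
apply/funext => n; rewrite /pseries /series /= summxE.
apply: eq_bigr => k _; rewrite expr_scalemx !mxE /exp_entry; ring.
Qed.

Lemma expmx0 : expmx (0 : 'M[R]_N) = 1%:M.
Proof.
(* The zero matrix is read as [0 *: 0], so that the entry formula applies at t = 0, where only the
   constant term remains. *)
apply/matrixP => i j; rewrite -(scale0r 0) expmx_entry.
rewrite (cvg_lim _ (@pseries0 _ _))//.
by rewrite /exp_entry fact0 divr1 expr0.
Qed.

(** Turns an entry of a product with the exponential into a single power series, whose coefficients
    can then be compared. *)
Lemma limn_pseries_sum (n : nat) (a : 'I_n -> R) (c : 'I_n -> R^nat) t :
  (forall l, exponential_type (c l)) ->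
  limn (pseries (fun k => \sum_l a l * c l k) t) =
  \sum_l a l * limn (pseries (c l) t).
Proof.
move=> ec; apply/cvg_lim => //.
rewrite (_ : pseries _ _ = fun m => \sum_l a l * pseries (c l) t m).
  apply: cvg_big => [|l _]; first exact: add_continuous.
  by apply: cvgMr; exact: cvg_exponential_type.
apply/funext => m; rewrite /pseries /series /=.
under eq_bigr do rewrite mulr_suml.
rewrite exchange_big /=; apply: eq_bigr => l _; rewrite mulr_sumr.
by apply: eq_bigr => k _; rewrite mulrA.
Qed.

Lemma pseries_diffs_exp_entry B i j :
  pseries_diffs (exp_entry B i j) = (fun k => (B ^+ k.+1) i j / k`!%:R).
Proof.
apply/funext => k; rewrite /pseries_diffs /exp_entry factS natrM; field.
by rewrite ?nat1r !pnatr_eq0 -lt0n fact_gt0.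
Qed.

Lemma is_derive_expmx B i j (t : R) :
  is_derive t 1 (fun t => expmx (t *: B) i j) ((B *m expmx (t *: B)) i j).
Proof.
have := is_derive_pseries t (exp_entry_exponential_type B i j).
rewrite pseries_diffs_exp_entry.
rewrite (_ : (fun k => _) = (fun k => \sum_l B i l * exp_entry B l j k)).
  rewrite limn_pseries_sum; last by move=> l; exact: exp_entry_exponential_type.
  rewrite mxE.
  under [X in is_derive _ _ _ X -> _]eq_bigr do rewrite -expmx_entry.
  by under [X in is_derive _ _ X _ -> _]eq_fun do rewrite -expmx_entry.
apply/funext => k; rewrite exprS mxE mulr_suml.
by apply: eq_bigr => l _; rewrite mulrA.
Qed.

(** Entries of both sides are power series with coefficients those of B^(k+1)/k!, one factor [B]
    being split off on the right or on the left. *)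
Lemma expmx_comm B t : expmx (t *: B) *m B = B *m expmx (t *: B).
Proof.
apply/matrixP => i j; rewrite !mxE.
under eq_bigr do rewrite expmx_entry mulrC.
under [RHS]eq_bigr do rewrite expmx_entry.
rewrite -!limn_pseries_sum; do ?by move=> l; exact: exp_entry_exponential_type.
congr (limn (pseries _ _)); apply/funext => k.
transitivity ((B ^+ k.+1) i j / k`!%:R).
  rewrite exprSr mxE mulr_suml; apply: eq_bigr => l _.
  by rewrite /exp_entry mulrCA mulrA.
by rewrite exprS mxE mulr_suml; apply: eq_bigr => l _; rewrite mulrA.
Qed.

End matrix_exponential.

(** * Solutions of the ODE and uniqueness for the homogeneous equation *)

Section trajectories.
Context {R : realType} {N : nat} (A : 'M[R]_N) (t1 : R).
Implicit Types (g h v w : R -> 'cV[R]_N) (x : 'cV[R]_N).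

Lemma is_trajectoryD g h v w : is_trajectory A g t1 v ->
  is_trajectory A h t1 w -> is_trajectory A (g + h) t1 (v + w).
Proof.
move=> [cv dv] [cw dw]; split; first exact: within_continuousD.
move=> t t01; have [dvt ev] := dv _ t01; have [dwt ew] := dw _ t01.
split; first exact: derivableD.
by rewrite deriveD// !fctE mulmxDr addrACA ev ew.
Qed.

Lemma is_trajectoryN g v :
  is_trajectory A g t1 v -> is_trajectory A (- g) t1 (- v).
Proof.
move=> [cv dv]; split; first by move=> t; apply: continuousN; exact: cv.
move=> t t01; have [dvt ev] := dv _ t01.
split; first exact: derivableN.
by rewrite deriveN// !fctE mulmxN -opprD ev.
Qed.

Lemma is_derive_flow x i j (t : R) :
  is_derive t 1 (fun t : R => (expmx (- (t *: A)) *m x) i j)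
    ((- (A *m (expmx (- (t *: A)) *m x))) i j).
Proof.
rewrite (_ : (fun t => _) =
    \sum_l ((x l j) \*: (fun t => expmx (t *: - A) i l))); last first.
  apply/funext => r; rewrite fct_sumE mxE; apply: eq_bigr => l _.
  by rewrite -scalerN mulrC.
have -> : (- (A *m (expmx (- (t *: A)) *m x))) i j =
    \sum_l x l j *: (- A *m expmx (t *: - A)) i l; last first.
  apply: is_derive_sum => l; apply: is_deriveZ; exact: is_derive_expmx.
rewrite -mulNmx mulmxA mxE; apply: eq_bigr => l _.
by rewrite -scalerN mulrC.
Qed.

Lemma flow_is_trajectory x :
  is_trajectory A 0 t1 (fun t => expmx (- (t *: A)) *m x).
Proof.
have dflow (t : R) : derivable (fun t : R => expmx (- (t *: A)) *m x) t 1.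
  by apply/derivable_mxP => i j; have [] := is_derive_flow x i j t.
split; first exact: derivable_within_continuous.
move=> t _; split => //; rewrite derive_mx//; apply/matrixP => i j.
rewrite mxE mxE; have [_ ->] := is_derive_flow x i j t.
by rewrite !mxE addNr.
Qed.

(* The flow run backwards along a solution, [E(T - t) w(t)], is constant. *)
Lemma homogeneous_trajectory w (T : R) : is_trajectory A 0 t1 w ->
  0 <= T <= t1 -> w T = expmx (- (T *: A)) *m w 0.
Proof.
move=> [cw dw] /andP[T0 T1].
apply/matrixP => i j.
pose E t l : R := expmx ((t - T) *: A) i l.
pose F t : R := \sum_l E t l * w t l j.
(* At t = T the exponential is the identity and [F] reads off [w T]; at t = 0 it is exp(-TA) applied
   to [w 0]. *)
suff : F T = F 0.
  rewrite /F /E subrr scale0r sub0r scaleNr expmx0 => FT.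
  rewrite mxE -FT (bigD1 i)//= mxE eqxx mul1r big1 ?addr0// => l li.
  by rewrite mxE eq_sym (negPf li) mul0r.
(* [A] is put to the right of the exponential, so that this term cancels the one from w' = -Aw in
   the product rule. *)
have dE (t : R) l : is_derive t 1 (E^~ l) ((expmx ((t - T) *: A) *m A) i l).
  rewrite expmx_comm.
  have dt : is_derive t 1 (fun t : R => t - T) 1.
    by rewrite -[X in is_derive _ _ _ X](subr0 1); exact: is_deriveB.
  have := @is_derive1_comp _ (fun r => expmx (r *: A) i l) _ t _ _
    (is_derive_expmx A i l (t - T)) dt.
  by rewrite mulr1.
have dF (t : R) : t \in `]0, T[ -> is_derive t 1 F 0.
  rewrite in_itv /= => /andP[t0 tT].
  have t01 : 0 < t < t1 by rewrite t0 (lt_le_trans tT).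
  have [/[dup] dwt /derivable_mxP dwij ew] := dw _ t01.
  rewrite (_ : F = \sum_l (E^~ l * (fun t => w t l j))); last first.
    by apply/funext => r; rewrite fct_sumE.
  have Dw l : is_derive t 1 (fun t : R => w t l j) (- (A *m w t) l j).
    have := derivableP (dwij l j).
    move/eqP: ew; rewrite addr_eq0 => /eqP/matrixP/(_ l j).
    by rewrite derive_mx// mxE => ->; rewrite mxE.
  rewrite (_ : 0 = \sum_l (E t l *: - (A *m w t) l j +
      w t l j *: (expmx ((t - T) *: A) *m A) i l)).
    by apply: is_derive_sum => l; apply: is_deriveM.
  rewrite big_split /= -[LHS](subrr ((expmx ((t - T) *: A) *m A *m w t) i j)).
  rewrite [RHS]addrC; congr (_ + _).
    by rewrite mxE; apply: eq_bigr => l _; rewrite /GRing.scale /= mulrC.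
  by rewrite -mulmxA [in LHS]mxE -sumrN; apply: eq_bigr => l _; rewrite scalerN.
(* The mean value theorem asks only for continuity at the ends of the interval; [w] need not be
   differentiable at 0 or [t1]. *)
have cF : {within `[0, T], continuous F}.
  have sub : `[0, T] `<=` `[0, t1].
    by apply: subset_itvl; rewrite bnd_simp.
  have {}cw := continuous_subspaceW sub cw.
  move=> t.
  apply: cvg_big => [|l _]; first exact: add_continuous.
  apply: cvgM.
    have : {within `[0, T], continuous E^~ l}.
      by apply: derivable_within_continuous => r _; have [] := dE r l.
    exact.
  exact: (cvg_comp _ _ (cw t) (@coord_continuous _ _ _ l j (w t))).
have [c _ Fc] := @MVT_segment _ F (fun=> 0) _ _ T0 dF cF.
by apply/eqP; rewrite -subr_eq0 Fc mul0r.
Qed.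

End trajectories.

(** * Gram matrices and coordinates in the basis of [W] *)

Section gram.
Context {R : realType}.

(** Serves twice: for the output norm, with matrix [G], and for the norm on [W], with matrix [S]. *)
Lemma dot_sum (U : lmodType R) (f : {dot U for idfun}) (s : nat)
    (y : 'I_s -> U) (xi : 'cV[R]_s) :
  f (\sum_i xi i 0 *: y i) (\sum_i xi i 0 *: y i) =
  bform (\matrix_(i, j) f (y i) (y j)) xi xi.
Proof.
rewrite bformE linear_sumlz; apply: eq_bigr => i _.
rewrite linear_sumr; apply: eq_bigr => j _.
by rewrite linearZl_LR linearZr_LR /= mxE; ring.
Qed.

Lemma dot_sym (U : lmodType R) (f : {dot U for idfun}) (x y : U) :
  f x y = f y x.
Proof. by rewrite hermC expr0 mul1r. Qed.

Lemma dot_ge0 (U : lmodType R) (f : {dot U for idfun}) (x : U) : 0 <= f x x.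
Proof.
have [->|x0] := eqVneq x 0; first by rewrite linear0l.
exact/ltW/neq0_dnorm_gt0.
Qed.

Lemma trmx_gramG (N p s : nat) (A : 'M[R]_N) (X : completeNormedModType R)
    (Phi : {linear 'cV[R]_N -> X}) (H : {linear X -> 'cV[R]_p}) (t1 : R)
    (Y : outputSpace R (time t1) p) (e : s.-tuple 'cV[R]_N) :
  (gramG A Phi H Y e)^T = gramG A Phi H Y e.
Proof. by apply/matrixP => i j; rewrite !mxE dot_sym. Qed.

Context {N s : nat} {W : {vspace 'cV[R]_N}}.
Context (ipN : {dot (subvs_of W) for idfun}).
Context (e : s.-tuple 'cV[R]_N) (e_basis : basis_of W e).

Definition lincomb (xi : 'cV[R]_s) : 'cV[R]_N := \sum_i xi i 0 *: tnth e i.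

Lemma trmx_gramS : (gramS ipN e)^T = gramS ipN e.
Proof. by apply/matrixP => i j; rewrite !mxE /ipW dot_sym. Qed.

Lemma lincomb_mem xi : lincomb xi \in W.
Proof.
rewrite /lincomb; apply: memv_suml => i _; apply: memvZ.
by apply: (basis_mem e_basis); exact: mem_tnth.
Qed.

Lemma mem_lincomb x : x \in W -> exists xi, x = lincomb xi.
Proof.
move=> xW; exists (\col_i coord e i x); rewrite {1}(coord_basis e_basis xW).
by apply: eq_bigr => i _; rewrite mxE (tnth_nth 0).
Qed.

Lemma lincomb_eq0 xi : lincomb xi = 0 -> xi = 0.
Proof.
move=> xi0; apply/colP => i; rewrite mxE.
have /freeP fe := basis_free e_basis.
apply: (fe (fun i => xi i 0)).
by rewrite -[RHS]xi0; apply: eq_bigr => j _; rewrite (tnth_nth 0).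
Qed.

Lemma ipW_lincomb xi :
  ipW ipN (lincomb xi) (lincomb xi) = bform (gramS ipN e) xi xi.
Proof.
rewrite /ipW /lincomb linear_sum /=.
under eq_bigr do rewrite linearZ /=.
exact: dot_sum.
Qed.

Lemma gramS_gt0 xi : xi != 0 -> 0 < bform (gramS ipN e) xi xi.
Proof.
move=> xi0; rewrite -ipW_lincomb; apply: neq0_dnorm_gt0.
apply: contra xi0 => /eqP/(congr1 vsval).
rewrite vsprojK ?lincomb_mem// linear0.
by move=> /lincomb_eq0 ->.
Qed.

End gram.

(** * Linearity of outputs and of their classes *)

Section output.
Context {R : realType}.

Lemma output_class_sum (T : Type) (p s : nat) (Y : outputSpace R T p)
    (f : 'I_s -> T -> 'cV[R]_p) (a : 'I_s -> R) :
  (forall i, f i \in output_fun Y) ->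
  output_class Y (\sum_i a i *: f i) = \sum_i a i *: output_class Y (f i).
Proof.
move=> fY; have [Y0 YD] := output_fun_submod Y.
have class0 : output_class Y 0 = 0.
  have := output_class_linear 1 Y0 Y0; rewrite scale1r addr0 scale1r.
  by move/eqP; rewrite -subr_eq0 opprD addNKr oppr_eq0 => /eqP.
(* [output_class] is linear only on [output_fun], so membership of the partial sums is carried
   through the induction. *)
suff [] : \sum_i a i *: f i \in output_fun Y /\
  output_class Y (\sum_i a i *: f i) = \sum_i a i *: output_class Y (f i) by [].
elim/big_rec2 : _ => // i x y _ [yY <-].
by split; [exact: YD|rewrite output_class_linear].
Qed.

Context {N p : nat} {X : completeNormedModType R} {t1 : R}.
Context (Phi : {linear 'cV[R]_N -> X}) (H : {linear X -> 'cV[R]_p}).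

(** Trajectories are total functions constrained only on [0, t1]; outputs see nothing else. *)
Lemma eq_output (v w : R -> 'cV[R]_N) :
  (forall t, 0 <= t <= t1 -> v t = w t) ->
  @output R N p X Phi H t1 v = output Phi H w.
Proof. by move=> vw; apply/funext => -[t t01]; rewrite /output /= vw. Qed.

Lemma outputB (v w : R -> 'cV[R]_N) :
  @output R N p X Phi H t1 (v - w) = output Phi H v - output Phi H w.
Proof. by apply/funext => t; rewrite /output !fctE !linearB. Qed.

Lemma output_sum (s : nat) (v : 'I_s -> R -> 'cV[R]_N) (a : 'I_s -> R) :
  @output R N p X Phi H t1 (fun t => \sum_i a i *: v i t) =
  \sum_i a i *: output Phi H (v i).
Proof.
apply/funext => t; rewrite fct_sumE /output !linear_sum.
by apply: eq_bigr => i _; rewrite !linearZ.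
Qed.

End output.

(** * Computation of [epsilonN] and of the unobservability index *)

Theorem mainTheorem3 (R : realType) (N p s : nat) (t1 : R) (t1_gt0 : 0 < t1)
  (A : 'M[R]_N) (g : R -> 'cV[R]_N)
  (g_cont : {within `[0, t1], continuous g})
  (X : completeNormedModType R)
  (Phi : {linear 'cV[R]_N -> X}) (H : {linear X -> 'cV[R]_p})
  (Y : outputSpace R (time t1) p)
  (W : {vspace 'cV[R]_N}) (ipN : {dot (subvs_of W) for idfun})
  (output_in_Y : forall v : R -> 'cV[R]_N,
    is_trajectory A g t1 v -> v 0 \in W -> output Phi H v \in output_fun Y)
  (e : s.-tuple 'cV[R]_N) (e_basis : basis_of W e)
  (rho : R) (rho_gt0 : 0 < rho)
  (u : R -> 'cV[R]_N) (u_traj : is_trajectory A g t1 u) (u0_W : u 0 \in W) :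
  let G := gramG A Phi H Y e in
  let S := gramS ipN e in
  ((0 < s)%N ->
    exists sigma_min : R, is_smallest_relative_eigenvalue G S sigma_min) /\
  forall sigma_min : R, is_smallest_relative_eigenvalue G S sigma_min ->
    (epsilonN A g Phi H Y ipN rho u ^+ 2 = (sigma_min * rho ^+ 2)%:E)%E /\
    unobservability_index A g Phi H Y ipN rho u
      = ((Num.sqrt sigma_min)%:E^-1)%E.
Proof.
move=> G S.
have GT : G^T = G by exact: trmx_gramG.
have ST : S^T = S by exact: trmx_gramS.
have Spos (xi : 'cV[R]_s) : xi != 0 -> 0 < bform S xi xi by exact: gramS_gt0.
split=> [s0|sigma smin].
  have [sigma [x x0 [Gx minx]]] := rayleigh_min G s0 Spos.
  by exists sigma; exact: rayleigh_eigenvalue Gx minx.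
pose flow (x : 'cV[R]_N) (t : R) := expmx (- (t *: A)) *m x.
have flow0 x : flow x 0 = x by rewrite /flow scale0r oppr0 expmx0 mul1mx.
have u_flow x : is_trajectory A g t1 (u + flow x).
  by rewrite -[g]addr0; apply: is_trajectoryD => //; exact: flow_is_trajectory.
have [Y0 YD] := output_fun_submod Y.
have uY : output Phi H u \in output_fun Y by exact: output_in_Y.
have diffY v : is_trajectory A g t1 v -> v 0 \in W ->
    output_class Y (output Phi H v) - output_class Y (output Phi H u) =
    output_class Y (output Phi H (v - u)) /\
    output Phi H (v - u) \in output_fun Y.
  move=> tv vW; have vY := output_in_Y _ tv vW.
  rewrite outputB addrC -scaleN1r [in RHS]addrC.
  rewrite -[X in _ = output_class Y (X + _) /\ _]scaleN1r.
  split; first by rewrite output_class_linear.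
  by rewrite addrC -scaleN1r YD.
(* [output_in_Y] concerns the forced equation, so the flow is reached as the difference of the
   trajectories [u + flow x] and [u]. *)
have flowY x : x \in W -> output Phi H (flow x) \in output_fun Y.
  move=> xW; have [] := diffY _ (u_flow x); first by rewrite fctE flow0 memvD.
  by rewrite [u + _]addrC addrK.
have norm_flow xi : `|output_class Y (output Phi H (flow (lincomb e xi)))| =
    Num.sqrt (bform G xi xi).
  rewrite output_normE -dot_sum; congr (Num.sqrt _).
  suff -> : output_class Y (output Phi H (flow (lincomb e xi))) =
    \sum_i xi i 0 *: output_class Y (output Phi H (flow (tnth e i))) by [].
  rewrite -output_class_sum; last first.
    by move=> i; rewrite flowY// (basis_mem e_basis)// mem_tnth.
  rewrite -output_sum; congr (output_class Y _); apply: eq_output => t _.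
  rewrite /flow /lincomb mulmx_sumr; apply: eq_bigr => i _.
  by rewrite -scalemxAr.
have norm_diff v xi : is_trajectory A g t1 v -> v 0 \in W ->
    v 0 - u 0 = lincomb e xi ->
    `|output_class Y (output Phi H v) - output_class Y (output Phi H u)| =
    Num.sqrt (bform G xi xi).
  move=> tv vW vxi; have [-> _] := diffY _ tv vW.
  rewrite -norm_flow; congr `|output_class Y _|; apply: eq_output => t t01.
  have tvu : is_trajectory A 0 t1 (v - u).
    by rewrite -(subrr g); apply: is_trajectoryD => //; exact: is_trajectoryN.
  by rewrite (homogeneous_trajectory tvu t01) fctE vxi.
(* In dimension 0 there is no nonzero eigenvector. *)
have s0 : (0 < s)%N.
  case: smin => -[x [x0 _]] _.
  case: s x x0 {e e_basis G S GT ST Spos norm_flow norm_diff}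
    => // x.
  by rewrite (flatmx0 x) eqxx.
have [sigma' [x x0 [Gx minx]]] := rayleigh_min G s0 Spos.
have smin' := rayleigh_eigenvalue GT ST Spos x0 Gx minx.
(* A smallest relative eigenvalue is unique, so the given one is the Rayleigh minimum attained at
   [x]. *)
have eqs : sigma' = sigma.
  apply/eqP; rewrite eq_le.
  by case: smin smin' => [e1 m1] [e2 m2]; rewrite m1// m2.
rewrite {}eqs {smin'} in Gx minx.
have Sx := Spos _ x0.
have Gx0 : 0 <= bform G x x by rewrite -dot_sum dot_ge0.
have sigma0 : 0 <= sigma by move: Gx0; rewrite Gx pmulr_lge0.
have normW_lincomb xi : normW ipN (lincomb e xi) = Num.sqrt (bform S xi xi).
  by rewrite /normW ipW_lincomb.
have epsE : epsilonN A g Phi H Y ipN rho u = (Num.sqrt sigma * rho)%:E.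
  apply/eqP; rewrite eq_le; apply/andP; split.
    (* Upper bound: [c] scales the minimiser to norm [rho], and the perturbation of [u] by its flow
       attains the claimed value. *)
    pose c := rho / Num.sqrt (bform S x x).
    have sS : 0 < Num.sqrt (bform S x x) by rewrite sqrtr_gt0.
    have sqrt_cS : Num.sqrt (c ^+ 2 * bform S x x) = rho.
      rewrite sqrtrM ?sqr_ge0// sqrtr_sqr ger0_norm ?divr_ge0// ?ltW//.
      by rewrite divfK// gt_eqF.
    apply: ereal_inf_lbound => /=.
    have W0 : lincomb e (c *: x) \in W by exact: lincomb_mem.
    exists (u + flow (lincomb e (c *: x))).
      split; [exact: u_flow|by rewrite fctE flow0 memvD|].
      rewrite fctE flow0 [u 0 + _]addrC addrK normW_lincomb bformZl bformZr.
      by rewrite mulrA -expr2 sqrt_cS.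
    congr (_%:E).
    rewrite (norm_diff _ (c *: x) (u_flow _)) ?fctE ?flow0 ?memvD//; last first.
      by rewrite [u 0 + _]addrC addrK.
    by rewrite bformZl bformZr mulrA -expr2 Gx mulrCA sqrtrM// sqrt_cS.
  (* Lower bound: every admissible [v] differs from [u] initially by a vector of norm [rho], to
     which the Rayleigh inequality applies. *)
  apply/ereal_infP => _ /= [v [tv vW nv] <-].
  have [xi vxi] := mem_lincomb e_basis (memvB vW u0_W).
  rewrite (norm_diff _ xi)// lee_fin.
  move: nv; rewrite vxi normW_lincomb => <-.
  by rewrite -sqrtrM// ler_wsqrtr.
rewrite /unobservability_index epsE; split.
  by rewrite -EFin_expe exprMn sqr_sqrtr.
(* If [sigma] is 0, both inverses are +oo and multiplying by [rho > 0] keeps +oo; otherwise this is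
   an identity between reals. *)
rewrite !inver mulf_eq0 (gt_eqF rho_gt0) orbF; case: ifPn => [_|s_n0].
  by rewrite mulry gtr0_sg// mul1e.
by rewrite -EFinM; congr (_%:E); field; rewrite s_n0 gt_eqF.
Qed.
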